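(* Let $G=(V,E)$ be a finite connected simple graph and let $\sigma:V\to\mathbb{N}_0$ be the initial chip configuration of a parallel chip-firing game on $G$. If $2|E|-|V|<|\sigma|<2|E|$, where $|\sigma|=\sum_{v\in V}\sigma(v)$, then the game has period $T=2$ and activity $\tfrac12$.
   Context: Let $\mathbb{N}_0=\{0,1,2,\dots\}$ and $d_v=\deg(v)$. A chip configuration is a map $\sigma:V\to\mathbb{N}_0$. The parallel chip-firing game: in each round, every vertex $v$ holding at least $d_v$ chips simultaneously fires, i.e. sends one chip to each of its neighbors (losing $d_v$ chips); all other vertices wait (send nothing). The step operator $U$ sends $\sigma$ to the configuration after one round: $$(U\sigma)(v)=\sigma(v)-d_v F(v)+\sum_{w:\{v,w\}\in E}F(w),$$ where $F(v)=1$ if $\sigma(v)\ge d_v$ and $F(v)=0$ otherwise. Put $U^0\sigma=\sigma$, $U^t\sigma=U(U^{t-1}\sigma)$, $\sigma_t=U^t\sigma$, and let $F_t(v)=1$ if $\sigma_t(v)\ge d_v$ and $F_t(v)=0$ otherwise. The period $T$ of the game is the smallest integer $T\ge1$ for which there exists $t\ge0$ with $U^t\sigma=U^{t+T}\sigma$ (it exists since there are finitely many configurations with a given number of chips). Let $t_0$ be the smallest such $t$. It is known (Jiang) that the number $q=\sum_{s=t_0}^{t_0+T-1}F_s(v)$ of firings in a complete period is the same for all vertices $v$; the activity of the game is $q/T$. *)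

(* Defs.v *)
(* MathComp; a simple graph on V is a symmetric irreflexive e : rel V. *)
From HB Require Import structures.
From mathcomp Require Import all_boot all_order all_algebra.

Set Implicit Arguments.
Unset Strict Implicit.
Unset Printing Implicit Defensive.

Section ParallelChipFiring.

Variables (V : finType) (e : rel V).

Definition connected_graph : Prop :=
  0 < #|V| /\ forall x y : V, connect e x y.

Definition edge_set : {set {set V}} :=
  [set [set x; y] | x in V, y in V & e x y].

Definition deg (v : V) : nat := #|[set w | e v w]|.

(* Finite functions, so that Leibniz equality of configurations is pointwise. *)
Definition config : predArgType := {ffun V -> nat}.

Definition chips (s : config) : nat := \sum_v s v.

Definition fires (s : config) (v : V) : bool := deg v <= s v.

(* Booleans are read as 0 or 1; the natural-number subtraction never
   truncates, since a firing vertex holds at least [deg v] chips. *)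
Definition step (s : config) : config :=
  [ffun v => s v - deg v * fires s v + \sum_(w | e v w) fires s w].

Definition config_at (s : config) (t : nat) : config := iter t step s.

Definition repeats (s : config) (T t : nat) : Prop :=
  config_at s t = config_at s (t + T).

Definition least_nat (P : nat -> Prop) (n : nat) : Prop :=
  P n /\ forall m, P m -> n <= m.

Definition is_period (s : config) (T : nat) : Prop :=
  least_nat (fun T' => 0 < T' /\ exists t, repeats s T' t) T.

Definition firings (s : config) (t0 T : nat) (v : V) : nat :=
  \sum_(t0 <= r < t0 + T) fires (config_at s r) v.

(* T, t0 and q are determined by s as soon as V is inhabited. *)
Definition is_activity (s : config) (a : rat) : Prop :=
  exists T t0 q : nat,
    [/\ is_period s T,
        least_nat (repeats s T) t0,
        forall v, firings s t0 T v = q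
      & a = (q%:R / T%:R)%R].

End ParallelChipFiring.

(* Main.v *)
(* Let F_t be the 0/1 firing vector and N_t = F_0 + ... + F_(t-1).  With L the
   graph Laplacian, sigma_t = sigma_0 - L N_t.  Along a cycle of length T we
   have L N_T = 0, so N_T is a constant q by connectivity, and because L is
   symmetric the sum over t of <F_t + F_(t+1), sigma_(t+1)>
   = <N_(t+2) - N_t, sigma_0 - L N_(t+1)> telescopes to 2 q |sigma|.  Hence, for
   any c : V -> int,
     sum_(t, v) (1 - F_t v - F_(t+1) v) (sigma_(t+1) v - c v)
       = (T - 2 q) (|sigma| - |c|).
   For c = deg and for c = deg - 1 every summand is nonpositive, which forces
   T = 2 q when |deg - 1| < |sigma| < |deg|; then all summands vanish, and
   subtracting the two families gives F_t + F_(t+1) = 1: every vertex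
   alternates, and sigma_2 = sigma_0. *)
Require Import Defs.
From HB Require Import structures.
From mathcomp Require Import all_boot all_order all_algebra.
From mathcomp Require Import zify ring.

Set Implicit Arguments.
Unset Strict Implicit.
Unset Printing Implicit Defensive.

Import Order.TTheory GRing.Theory Num.Theory.

Section Graph.

Variables (V : finType) (e : rel V).
Hypotheses (e_sym : symmetric e) (e_irr : irreflexive e).

(** * Edges as two-element sets, and the handshake identity *)

Lemma edge_setP (A : {set V}) :
  reflect (exists x y, e x y /\ A = [set x; y]) (A \in edge_set e).
Proof.
apply: (iffP imset2P) => [[x y _] | [x [y [exy ->]]]].
  by rewrite !inE => exy ->; exists x, y.
by exists x y; rewrite ?inE.
Qed.

Lemma deg_incident v : deg e v = #|[set A in edge_set e | v \in A]|.
Proof.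
rewrite /deg -(@card_in_imset _ _ (fun w => [set v; w])); last first.
  move=> w w'; rewrite !inE => evw evw' /setP /(_ w).
  rewrite !inE eqxx orbT => /esym /orP[/eqP wv|/eqP //].
  by rewrite wv e_irr in evw.
apply: eq_card => A; rewrite !inE; apply/imsetP/andP.
  move=> [w]; rewrite inE => evw ->; rewrite !inE eqxx; split=> //.
  by apply/edge_setP; exists v, w.
move=> [/edge_setP[x [y [exy ->]]]]; rewrite !inE => /orP[]/eqP->.
  by exists y; rewrite ?inE.
by exists x; rewrite ?inE 1?e_sym // setUC.
Qed.

(** Incident pairs of a vertex and an edge are counted in both orders. *)
Lemma sum_deg : \sum_v deg e v = 2 * #|edge_set e|.
Proof.
under eq_bigr => v _ do rewrite deg_incident -sum1_card.
rewrite (exchange_big_dep (mem (edge_set e))) /=; last first.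
  by move=> v A _; rewrite inE => /andP[].
rewrite (eq_bigr (fun=> 2)) ?sum_nat_const 1?mulnC // => A AE.
have [x [y [exy defA]]] := edge_setP _ AE.
have xy : x != y by apply: contraTneq exy => ->; rewrite e_irr.
(* The constant 2 is recast as [(x != y).+1], the form in which [cards2] gives the size of
   [[set x; y]]. *)
rewrite -[RHS]/(true.+1) -xy -cards2 -defA -sum1_card; apply: eq_bigl => z.
by rewrite inE AE.
Qed.

Local Open Scope ring_scope.

(** * The graph Laplacian over the integers *)

Lemma edge_sum_swap (g : V -> V -> int) :
  \sum_v \sum_(w | e v w) g v w = \sum_v \sum_(w | e v w) g w v.
Proof.
rewrite (exchange_big_dep predT) //=; apply: eq_bigr => v _.
by apply: eq_bigl => w; rewrite e_sym.
Qed.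

Lemma sum_nbr_const v (c : int) : \sum_(w | e v w) c = (deg e v)%:Z * c.
Proof. by rewrite sumr_const /deg cardsE -mulr_natl natz. Qed.

Definition laplacian (f : V -> int) (v : V) : int :=
  (deg e v)%:Z * f v - \sum_(w | e v w) f w.

Lemma laplacianD f g v :
  laplacian (fun w => f w + g w) v = laplacian f v + laplacian g v.
Proof. by rewrite /laplacian big_split /=; ring. Qed.

Lemma laplacian_const c v : laplacian (fun=> c) v = 0.
Proof. by rewrite /laplacian sum_nbr_const subrr. Qed.

Lemma eq_laplacian f g v : f =1 g -> laplacian f v = laplacian g v.
Proof. by move=> fg; rewrite /laplacian fg; under eq_bigr do rewrite fg. Qed.

Lemma laplacian_sym f g :
  \sum_v f v * laplacian g v = \sum_v g v * laplacian f v.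
Proof.
rewrite /laplacian; under eq_bigr do rewrite mulrBr mulr_sumr.
under [RHS]eq_bigr do rewrite mulrBr mulr_sumr.
rewrite !sumrB edge_sum_swap; congr (_ - _).
  by apply: eq_bigr => v _; ring.
by apply: eq_bigr => v _; apply: eq_bigr => w _; rewrite mulrC.
Qed.

Lemma sum_laplacian f : \sum_v laplacian f v = 0.
Proof.
have := laplacian_sym (fun=> 1) f.
under eq_bigr do rewrite mul1r.
by move=> ->; rewrite big1 // => v _; rewrite laplacian_const mulr0.
Qed.

(** Expand the square; the factor 2 appears because every edge is summed in both directions. *)
Lemma dirichlet_energy f :
  \sum_v \sum_(w | e v w) (f v - f w) ^+ 2 = 2 * \sum_v f v * laplacian f v.
Proof.
have sq v : \sum_(w | e v w) f v ^+ 2 = (deg e v)%:Z * f v ^+ 2.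
  exact: sum_nbr_const.
transitivity (\sum_v \sum_(w | e v w) f v ^+ 2
    + \sum_v \sum_(w | e v w) f w ^+ 2
    - 2 * \sum_v \sum_(w | e v w) f v * f w).
  rewrite mulr_sumr -big_split -sumrB /=; apply: eq_bigr => v _.
  rewrite mulr_sumr -big_split -sumrB /=; apply: eq_bigr => w _; ring.
rewrite (edge_sum_swap (fun v w => f w ^+ 2)) (eq_bigr _ (fun v _ => sq v)).
rewrite -big_split /= !mulr_sumr -sumrB; apply: eq_bigr => v _.
by rewrite /laplacian -mulr_sumr; ring.
Qed.

(** A harmonic [f] has zero Dirichlet energy, so every square vanishes and [f] agrees across each
    edge, hence along paths. *)
Lemma harmonic_const f : connected_graph e ->
  (forall v, laplacian f v = 0) -> forall v w, f v = f w.
Proof.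
move=> [_ conn] harm; have edge0 v w : e v w -> f v = f w.
  move=> evw; have := dirichlet_energy f.
  rewrite (_ : \sum_u f u * laplacian f u = 0) ?mulr0; last first.
    by rewrite big1 // => u _; rewrite harm mulr0.
  have ge0 u : 0 <= \sum_(z | e u z) (f u - f z) ^+ 2.
    by apply: sumr_ge0 => z _; apply: sqr_ge0.
  move/eqP; rewrite psumr_eq0 // => /allP /(_ v).
  rewrite mem_index_enum => /(_ isT) /=.
  rewrite psumr_eq0 => [/allP /(_ w)|z _]; last exact: sqr_ge0.
  by rewrite mem_index_enum evw => /(_ isT) /=; rewrite sqrf_eq0 subr_eq0 => /eqP.
move=> v w; have /connectP[p] := conn v w.
elim: p v => [|u p IH] v /=; first by move=> _ ->.
by move=> /andP[/edge0 -> pth] lst; apply: IH.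
Qed.

(** * The game in terms of its odometer *)

Section Dynamics.

Variable s : config V.

Let x t v : int := (config_at e s t v)%:Z.
Let F t v : int := (fires e (config_at e s t) v : nat)%:Z.

Definition odometer t v : int :=
  \sum_(i < t) (fires e (config_at e s i) v : nat)%:Z.

Local Notation N := odometer.

Lemma odometerS t v : N t.+1 v = N t v + F t v.
Proof. by rewrite /odometer big_ord_recr. Qed.

Lemma config_atS t v : x t.+1 v = x t v - laplacian (F t) v.
Proof.
rewrite /x /laplacian /F /config_at iterS ffunE.
set c := iter t _ s; rewrite PoszD -subzn; last first.
  by case: (boolP (fires e c v)) => h; rewrite ?muln1 ?muln0.
rewrite PoszM (big_morph Posz PoszD (erefl 0%:Z)); ring.
Qed.

Lemma config_at_odometer t v : x t v = x 0 v - laplacian (N t) v.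
Proof.
elim: t => [|t IH].
  rewrite (@eq_laplacian _ (fun=> 0)) ?laplacian_const ?subr0 // => w.
  by rewrite /odometer big_ord0.
rewrite config_atS IH (eq_laplacian _ (odometerS t)) laplacianD; ring.
Qed.

Lemma chips_config_at t : chips (config_at e s t) = chips s.
Proof.
apply/eqP; rewrite -eqz_nat /chips !(big_morph Posz PoszD (erefl 0%:Z)).
rewrite (eq_bigr _ (fun v _ => config_at_odometer t v)) sumrB sum_laplacian.
by rewrite subr0.
Qed.

(** The summand is the pairing of [N t.+2 - N t] with [x 0 - laplacian (N t.+1)]; symmetry of the
    Laplacian makes the quadratic parts cancel in succession. The term [N 1] is the lower boundary,
    as [N 0 = 0]. *)
Lemma energy_telescope T :
  \sum_(t < T) \sum_v (F t v + F t.+1 v) * x t.+1 v =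
  \sum_v (N T.+1 v + N T v - N 1 v) * x 0 v
  - \sum_v N T.+1 v * laplacian (N T) v.
Proof.
have N0 v : N 0 v = 0 by rewrite /odometer big_ord0.
elim: T => [|T IH].
  rewrite big_ord0 (laplacian_sym (N 1)) !big1 ?subrr // => v _; rewrite N0 ?mul0r //.
  by ring.
rewrite big_ord_recr /= IH (laplacian_sym (N T.+1) (N T)).
rewrite -sumrB -big_split -[RHS]sumrB /=; apply: eq_bigr => v _.
rewrite (config_at_odometer T.+1); have := odometerS T v; have := odometerS T.+1 v.
by move=> -> ->; ring.
Qed.

(** * Configurations lying on a cycle *)

Hypothesis e_conn : connected_graph e.
Variable T : nat.
Hypothesis cycle : config_at e s T = s.

Lemma cycle_odometer_const : exists q, forall v, N T v = q.
Proof.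
have harm v : laplacian (N T) v = 0.
  have := config_at_odometer T v; rewrite /x cycle -[config_at e s 0]/s; lia.
have [/card_gt0P[v0 _] _] := e_conn.
by exists (N T v0) => v; apply: harmonic_const harm _ _.
Qed.

(** Here [q] precedes [c], so that the two thresholds compared later share one [q]. *)
Lemma cycle_energy : exists q : int, forall c : V -> int,
  \sum_(t < T) \sum_v (1 - F t v - F t.+1 v) * (x t.+1 v - c v) =
  (T%:Z - 2 * q) * ((chips s)%:Z - \sum_v c v).
Proof.
have [q NT] := cycle_odometer_const; exists q => c.
have NT1 v : N T.+1 v = q + N 1 v.
  rewrite odometerS NT /F cycle; congr (_ + _).
  by rewrite /odometer big_ord1.
have sumx t : \sum_v x t v = (chips s)%:Z.
  by rewrite -(chips_config_at t) /chips (big_morph Posz PoszD (erefl 0%:Z)).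
have sumF v : \sum_(t < T) (F t v + F t.+1 v) = 2 * q.
  have -> : \sum_(t < T) (F t v + F t.+1 v) = N T v + N T.+1 v - N 1 v.
    rewrite big_split /= -/(N T v) -addrA; congr (_ + _).
    by rewrite /odometer big_ord_recl big_ord1 addrAC subrr add0r.
  by rewrite NT1 NT; ring.
(* After expansion the three sums are evaluated by chip conservation, by [energy_telescope] and by
   [sumF]. *)
transitivity (\sum_(t < T) (\sum_v x t.+1 v - \sum_v c v)
  - \sum_(t < T) \sum_v (F t v + F t.+1 v) * x t.+1 v
  + \sum_v (\sum_(t < T) (F t v + F t.+1 v)) * c v).
  under [in X in _ + X]eq_bigr do rewrite mulr_suml.
  rewrite exchange_big /= [in X in _ + X]exchange_big [LHS]exchange_big /=.
  rewrite -sumrB -big_split /=; apply: eq_bigr => t _.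
  rewrite -!sumrB -big_split /=; apply: eq_bigr => v _; ring.
rewrite energy_telescope; under eq_bigr do rewrite sumx.
rewrite sumr_const card_ord.
under [in X in _ + X]eq_bigr do rewrite sumF.
under [X in _ - (X - _) + _]eq_bigr do rewrite NT1 NT addrAC addrK.
rewrite (_ : \sum_v N T.+1 v * laplacian (N T) v = 0); last first.
  by apply: big1 => v _; rewrite (eq_laplacian _ NT) laplacian_const mulr0.
rewrite -!mulr_sumr sumx -mulr_natl natz; ring.
Qed.

Hypotheses (lower : (2 * #|edge_set e|)%:Z - #|V|%:Z < (chips s)%:Z)
  (upper : (chips s < 2 * #|edge_set e|)%N).

Lemma cycle_alternates t v : (t < T)%N -> F t v + F t.+1 v = 1.
Proof.
have [q en] := cycle_energy => tT.
have sumd : \sum_v (deg e v)%:Z = (2 * #|edge_set e|)%:Z.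
  by rewrite -sum_deg (big_morph Posz PoszD (erefl 0%:Z)).
pose d v := (deg e v)%:Z; pose d1 v := d v - 1.
have sumd1 : \sum_v d1 v = (2 * #|edge_set e|)%:Z - #|V|%:Z.
  by rewrite sumrB sumd sumr_const cardT -cardE natz.
have fires_iff r u : (F r u = 1 /\ d u <= x r u) \/ (F r u = 0 /\ x r u <= d1 u).
  rewrite /F /x /d1 /d /fires; case: leqP => h; [left | right]; split=> //; lia.
have fires01 r u : F r u = 0 \/ F r u = 1 by rewrite /F; case: fires; [right | left].
pose term (c : V -> int) r u := (1 - F r u - F r.+1 u) * (x r.+1 u - c u).
have d_le0 r u : term d r u <= 0.
  by rewrite /term; have:= fires_iff r.+1 u; have := fires01 r u; rewrite /d1; nia.
have d1_le0 r u : term d1 r u <= 0.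
  by rewrite /term; have:= fires_iff r.+1 u; have := fires01 r u; rewrite /d1; nia.
(* With [a] the first factor, the two terms add up to [a * (2 * (x r.+1 u - d u) + 1)]. The second
   factor is at least 1 when [u] fires at time [r.+1], where [a <= 0], and at most -1 otherwise,
   where [a >= 0]. *)
have sq_le r u : (1 - F r u - F r.+1 u) ^+ 2 <= - (term d r u + term d1 r u).
  rewrite /term expr2.
  by have:= fires_iff r.+1 u; have := fires01 r u; rewrite /d1; nia.
have := en d; have := en d1; rewrite sumd sumd1.
have sum_le0 (c : V -> int) : (forall r u, term c r u <= 0) ->
    \sum_(r < T) \sum_u term c r u <= 0.
  by move=> c_le0; apply: sumr_le0 => r _; apply: sumr_le0.
have := sum_le0 _ d_le0; have := sum_le0 _ d1_le0.
set Sd := \sum_(r < T) \sum_u term d r u.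
set Sd1 := \sum_(r < T) \sum_u term d1 r u.
rewrite -/(term d) -/(term d1) -/Sd -/Sd1 => Sd1_le0 Sd_le0 eqd1 eqd.
(* The factors multiplying [T - 2 q] in [eqd] and [eqd1] have opposite strict signs, by [upper] and
   [lower], while both products are nonpositive. *)
have Tq : T%:Z - 2 * q = 0 by nia.
have {eqd eqd1} Sd0 : Sd + Sd1 = 0 by rewrite eqd eqd1 Tq; ring.
have sq0 : \sum_(r < T) \sum_u (1 - F r u - F r.+1 u) ^+ 2 == 0.
  rewrite eq_le; apply/andP; split; last first.
    by apply: sumr_ge0 => r _; apply: sumr_ge0 => u _; apply: sqr_ge0.
  rewrite [leRHS](_ : _ = - (Sd + Sd1)); last by rewrite Sd0 oppr0.
  rewrite -big_split -sumrN /=; apply: ler_sum => r _.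
  by rewrite -big_split -sumrN /=; apply: ler_sum => u _; apply: sq_le.
have row_ge0 (r : 'I_T) : 0 <= \sum_u (1 - F r u - F r.+1 u) ^+ 2.
  by apply: sumr_ge0 => u _; apply: sqr_ge0.
move: sq0; rewrite psumr_eq0 // => /allP /(_ (Ordinal tT)).
rewrite mem_index_enum => /(_ isT) /=; rewrite psumr_eq0 => [/allP /(_ v)|u _];
  last exact: sqr_ge0.
rewrite mem_index_enum => /(_ isT) /=; rewrite sqrf_eq0 => /eqP; lia.
Qed.

Lemma cycle_step2 : (0 < T)%N ->
  (forall v, fires e (step e s) v = ~~ fires e s v) /\ step e (step e s) = s.
Proof.
move=> T_gt0; have alt v : fires e (step e s) v = ~~ fires e s v.
  have := cycle_alternates v T_gt0; rewrite /F /=.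
  by case: (fires e s v); case: (fires e _ v).
split=> //; apply/ffunP => v; apply/eqP; rewrite -eqz_nat; apply/eqP.
have F1 : F 1 =1 (fun v => 1 - F 0 v).
  by move=> w; have := cycle_alternates w T_gt0; lia.
rewrite -[LHS]/(x 2 v) -[RHS]/(x 0 v) 2!config_atS.
(* Over two rounds every vertex fires exactly once, and a constant firing vector moves no net
   chips. *)
have lap0 : laplacian (F 0) v + laplacian (F 1) v = 0.
  rewrite -laplacianD (@eq_laplacian _ (fun=> 1)) ?laplacian_const // => w.
  by rewrite F1; ring.
lia.
Qed.

End Dynamics.

(** * Existence of a cycle, and the exact period *)

Lemma config_at_add s m n :
  config_at e s (m + n) = config_at e (config_at e s m) n.
Proof. by rewrite /config_at addnC iterD. Qed.

(** Pigeonhole: conservation bounds each entry by [chips s], leaving finitely many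
    configurations. *)
Lemma eventually_periodic s : exists t T, (0 < T)%N /\ repeats e s T t.
Proof.
have bound t v : (config_at e s t v < (chips s).+1)%N.
  by rewrite -(chips_config_at s t) ltnS /chips (bigD1 v) //= leq_addr.
pose g (t : 'I_#|{ffun V -> 'I_(chips s).+1}|.+1) :=
  [ffun v => Ordinal (bound t v)].
have /injectivePn[i [j ij gij]] : ~~ injectiveb g.
  by apply/injectiveP => /leq_card; rewrite [leqLHS]card_ord ltnn.
have eq_ij : config_at e s i = config_at e s j.
  by apply/ffunP => v; have /ffunP/(_ v) := gij; rewrite !ffunE => /(congr1 val).
have lt (a b : nat) : (a < b)%N -> config_at e s a = config_at e s b ->
    exists t T, (0 < T)%N /\ repeats e s T t.
  move=> ab eq_ab; exists a, (b - a)%N.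
  by rewrite subn_gt0 /repeats subnKC // ltnW.
by have [/lt|/lt|/val_inj /eqP] := ltngtP i j; [apply | apply | rewrite (negPf ij)].
Qed.

End Graph.

Theorem theorem1p2 (V : finType) (e : rel V)
    (e_sym : symmetric e) (e_irr : irreflexive e)
    (e_conn : connected_graph e) (s : config V)
    (lower : ((2 * #|edge_set e|)%:Z - #|V|%:Z < (chips s)%:Z)%R)
    (upper : chips s < 2 * #|edge_set e|) :
  is_period e s 2 /\ is_activity e s (1 / 2%:R)%R.
Proof.
(* The game is restarted at time [t]; both bounds survive because chips are conserved. *)
have cycle t T : 0 < T -> repeats e s T t ->
    (forall v, fires e (step e (config_at e s t)) v
               = ~~ fires e (config_at e s t) v)
    /\ step e (step e (config_at e s t)) = config_at e s t.
  move=> T_gt0 rep; apply: (@cycle_step2 _ _ e_sym e_irr _ e_conn T) => //.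
  - by rewrite -config_at_add.
  - by rewrite chips_config_at.
  - by rewrite chips_config_at.
have [t1 [T1 [T1_gt0 rep1]]] := eventually_periodic e_sym s.
have rep2 : repeats e s 2 t1.
  by rewrite /repeats config_at_add /= (cycle _ _ T1_gt0 rep1).2.
have period2 : is_period e s 2.
  split; first by split=> //; exists t1.
  move=> [|[|T]] [// _ [t rep]].
  have [/card_gt0P[v _] _] := e_conn.
  (* Period 1 is impossible: at a fixed configuration [v] would both fire and wait. *)
  have [/(_ v) alt _] := cycle _ 1 isT rep; move: alt.
  rewrite -[step e _]/(config_at e _ 1) -config_at_add -rep.
  by case: fires.
split=> //.
have exrep : exists t, config_at e s t == config_at e s (t + 2).
  by exists t1; apply/eqP.
(* The firing count is 1, since each vertex fires in exactly one of two consecutive rounds of the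
   cycle. *)
exists 2, (ex_minn exrep), 1; case: ex_minnP => t0 /eqP rep0 min0; split=> //.
  by split=> // m /eqP; apply: min0.
move=> v; have [alt _] := cycle _ 2 isT rep0.
rewrite /firings addn2 big_nat_recr // big_nat1 /= [fires e (step _ _) v]alt.
by case: fires.
Qed.
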